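(* Let $(M,\eta,\omega)$ be a compact cosymplectic manifold, and let $X$ be a co-Hamiltonian vector field on $M$ such that $I_{\eta,\omega}(X)=dG$. If $\Phi_X$ is the co-Hamiltonian flow generated by $X$, then the function $G$ is constant along the orbits of $\Phi_X$.
   Context: A cosymplectic structure on a smooth manifold $M$ is a pair $(\eta,\omega)$ of a closed $1$-form $\eta$ and a closed $2$-form $\omega$ such that for each $x\in M$ the linear map $T_xM\to T_x^\ast M$, $Y\mapsto \iota(Y)\omega_x+\eta_x(Y)\eta_x$ is a bijection. For a vector field $X$ put $I_{\eta,\omega}(X):=\iota(X)\omega+\eta(X)\eta$. A vector field $X$ is cosymplectic if $\mathcal{L}_X\eta=0$ and $\mathcal{L}_X\omega=0$; it is co-Hamiltonian if it is cosymplectic and the $1$-form $I_{\eta,\omega}(X)$ is exact, i.e. $I_{\eta,\omega}(X)=dG$ for some $G\in C^\infty(M,\mathbb{R})$. *)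

(* Defs.v *)
From HB Require Import structures.
From mathcomp Require Import all_boot all_order all_algebra.
From mathcomp Require Import all_classical all_reals all_analysis.

Set Implicit Arguments.
Unset Strict Implicit.
Unset Printing Implicit Defensive.

Import Order.TTheory GRing.Theory Num.Theory.
Import numFieldNormedType.Exports.

Local Open Scope classical_set_scope.
Local Open Scope ring_scope.

(* A is meant to be open: [differentiable] and ['D_v] look at full
   neighbourhoods of the points of A. *)
Fixpoint Ck_on (R : realType) (V W : normedModType R) (k : nat)
    (A : set V) (f : V -> W) : Prop :=
  match k with
  | 0 => {in A, continuous f}
  | k'.+1 => (forall p, A p -> differentiable f p) /\
             (forall v : V, Ck_on k' A (fun p => 'D_v f p))
  end.

Definition smooth_on (R : realType) (V W : normedModType R)
    (A : set V) (f : V -> W) : Prop :=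
  forall k, Ck_on k A f.

(* [chart_map] and [chart_inv] are total functions; their values outside
   [chart_dom] and [chart_cod] are irrelevant. *)
Record chart (R : realType) (n : nat) (T : topologicalType) := Chart {
  chart_dom : set T;
  chart_cod : set 'rV[R]_n;
  chart_map :> T -> 'rV[R]_n;
  chart_inv : 'rV[R]_n -> T;
  chart_dom_open : open chart_dom;
  chart_cod_open : open chart_cod;
  chart_map_cod : forall x, chart_dom x -> chart_cod (chart_map x);
  chart_inv_dom : forall p, chart_cod p -> chart_dom (chart_inv p);
  chart_mapK : forall x, chart_dom x -> chart_inv (chart_map x) = x;
  chart_invK : forall p, chart_cod p -> chart_map (chart_inv p) = p;
  chart_map_cont : {in chart_dom, continuous chart_map};
  chart_inv_cont : {in chart_cod, continuous chart_inv}
}.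

Definition transition (R : realType) (n : nat) (T : topologicalType)
    (c d : chart R n T) : 'rV[R]_n -> 'rV[R]_n :=
  fun p => d (chart_inv c p).

(* Smooth manifolds without boundary, of pure dimension n.  The atlas need not
   be maximal.  [chart_at] selects one chart of the atlas around each point. *)
Record manifold (R : realType) (n : nat) := Manifold {
  points :> topologicalType;
  atlas : set (chart R n points);
  chart_at : points -> chart R n points;
  manifold_hausdorff : hausdorff_space points;
  manifold_second_countable : @second_countable points;
  chart_at_atlas : forall x, atlas (chart_at x);
  chart_at_dom : forall x, chart_dom (chart_at x) x;
  atlas_compatible : forall c d, atlas c -> atlas d ->
    smooth_on (c @` (chart_dom c `&` chart_dom d)) (transition c d)
}.

(* T_xM is modelled as R^n through the selected chart at x; components in the
   other charts around x are obtained by applying the differentials of the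
   transition maps, see [vcomp] and [coordv]. *)
Notation tangent R n := ('rV[R]_n) (only parsing).
Notation cotangent R n := 'Hom('rV[R]_n, R^o) (only parsing).

Section Calculus.
Context (R : realType) (n : nat) (M : manifold R n).

Definition vector_field := forall x : M, tangent R n.
Definition form1 := forall x : M, cotangent R n.
(* A bilinear form on T_xM in curried form, so that [w x Y] is the contraction
   of w with Y; skew-symmetry is the predicate [alternating]. *)
Definition form2 := forall x : M, 'Hom(tangent R n, cotangent R n).

Definition alternating (w : form2) : Prop := forall x v, w x v v = 0.

Definition smooth_fun (f : M -> R) : Prop :=
  forall c, atlas c -> smooth_on (chart_cod c) (fun p => f (chart_inv c p)).

Definition differential (f : M -> R) : form1 := fun x =>
  let c := chart_at x in
  linfun ('d (fun p => f (chart_inv c p) : R^o) (c x)).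

(* Below, p ranges over [chart_cod c] and stands for the point
   [chart_inv c p] of M. *)

(* components of X in the chart c *)
Definition vcomp (X : vector_field) (c : chart R n M) (p : 'rV[R]_n)
    : 'rV[R]_n :=
  let x := chart_inv c p in
  'd (transition (chart_at x) c) (chart_at x x) (X x).

(* the k-th coordinate vector of the chart c, as a tangent vector *)
Definition coordv (c : chart R n M) (k : 'I_n) (p : 'rV[R]_n)
    : tangent R n :=
  'd (transition c (chart_at (chart_inv c p))) p (delta_mx 0 k).

Definition comp1 (a : form1) (c : chart R n M) (k : 'I_n) (p : 'rV[R]_n) : R :=
  a (chart_inv c p) (coordv c k p).

Definition comp2 (w : form2) (c : chart R n M) (k l : 'I_n) (p : 'rV[R]_n) : R :=
  w (chart_inv c p) (coordv c k p) (coordv c l p).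

Definition smooth_vector_field (X : vector_field) : Prop :=
  forall c, atlas c -> smooth_on (chart_cod c) (vcomp X c).

Definition smooth_form1 (a : form1) : Prop :=
  forall c k, atlas c -> smooth_on (chart_cod c) (comp1 a c k).

Definition smooth_form2 (w : form2) : Prop :=
  forall c k l, atlas c -> smooth_on (chart_cod c) (comp2 w c k l).

Definition partial (k : 'I_n) (f : 'rV[R]_n -> R) (p : 'rV[R]_n) : R :=
  'D_(delta_mx 0 k) f p.

(* components of the exterior derivatives in the chart c *)
Definition ext_d1 (a : form1) (c : chart R n M) (k l : 'I_n)
    (p : 'rV[R]_n) : R :=
  partial k (comp1 a c l) p - partial l (comp1 a c k) p.

Definition ext_d2 (w : form2) (c : chart R n M) (k l m : 'I_n)
    (p : 'rV[R]_n) : R :=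
  partial k (comp2 w c l m) p + partial l (comp2 w c m k) p
  + partial m (comp2 w c k l) p.

Definition closed1 (a : form1) : Prop :=
  forall c k l p, atlas c -> chart_cod c p -> ext_d1 a c k l p = 0.

Definition closed2 (w : form2) : Prop :=
  forall c k l m p, atlas c -> chart_cod c p -> ext_d2 w c k l m p = 0.

(* components of the Lie derivatives in the chart c:
   (L_X a)_k = X^j d_j a_k + a_j d_k X^j and
   (L_X w)_kl = X^j d_j w_kl + w_jl d_k X^j + w_kj d_l X^j *)
Definition lie1 (X : vector_field) (a : form1) (c : chart R n M) (k : 'I_n)
    (p : 'rV[R]_n) : R :=
  \sum_(j < n) (vcomp X c p 0 j * partial j (comp1 a c k) p
                + comp1 a c j p * partial k (fun q => vcomp X c q 0 j) p).

Definition lie2 (X : vector_field) (w : form2) (c : chart R n M) (k l : 'I_n)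
    (p : 'rV[R]_n) : R :=
  \sum_(j < n) (vcomp X c p 0 j * partial j (comp2 w c k l) p
                + comp2 w c j l p * partial k (fun q => vcomp X c q 0 j) p
                + comp2 w c k j p * partial l (fun q => vcomp X c q 0 j) p).

Definition flat_at (eta : form1) (w : form2) (x : M) (Y : tangent R n)
    : cotangent R n :=
  w x Y + (eta x Y : R) *: eta x.

Definition flat (eta : form1) (w : form2) (X : vector_field) : form1 :=
  fun x => flat_at eta w x (X x).

Definition is_cosymplectic (eta : form1) (w : form2) : Prop :=
  [/\ smooth_form1 eta /\ closed1 eta,
      [/\ alternating w, smooth_form2 w & closed2 w]
    & forall x : M, bijective (flat_at eta w x)].

Definition cosymplectic_field (eta : form1) (w : form2) (X : vector_field)
    : Prop :=
  [/\ smooth_vector_field X,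
      forall c k p, atlas c -> chart_cod c p -> lie1 X eta c k p = 0
    & forall c k l p, atlas c -> chart_cod c p -> lie2 X w c k l p = 0].

Definition exact1 (a : form1) : Prop :=
  exists2 G : M -> R, smooth_fun G & a = differential G.

Definition coHamiltonian (eta : form1) (w : form2) (X : vector_field) : Prop :=
  cosymplectic_field eta w X /\ exact1 (flat eta w X).

(* Continuity of the curve at t makes the chart expression of the curve
   meaningful near t. *)
Definition has_velocity (g : R -> M) (t : R) (v : tangent R n) : Prop :=
  {for t, continuous g} /\
  is_derive t 1 (fun s => chart_at (g t) (g s)) v.

(* (global) flow of X: Phi t x is the value at time t of the integral curve of
   X starting at x *)
Definition is_flow (X : vector_field) (Phi : R -> M -> M) : Prop :=
  (forall x, Phi 0 x = x) /\
  (forall x t, has_velocity (fun s => Phi s x) t (X (Phi t x))).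

Definition flow_orbit (Phi : R -> M -> M) (x : M) : set M :=
  [set y | exists t, y = Phi t x].

End Calculus.

(* Main.v *)
Require Import Defs.
From HB Require Import structures.
From mathcomp Require Import all_boot all_order all_algebra.
From mathcomp Require Import all_classical all_reals all_analysis.

Set Implicit Arguments.
Unset Strict Implicit.
Unset Printing Implicit Defensive.

Import Order.TTheory GRing.Theory Num.Theory.
Import numFieldNormedType.Exports.
Local Open Scope classical_set_scope.
Local Open Scope ring_scope.

(** Contracting the 1-form dG = iota(X) w + eta(X) eta with X kills the first
    term, since w is alternating, so dG(X) = eta(X)^2 ([flat_diag]).  It is
    therefore enough to see that eta(X) vanishes along the flow line of x.

    Cartan's formula and d eta = 0 give d(eta(X)) = L_X eta = 0.  In a chart
    this is a computation with components: by closedness the partial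
    derivatives of sum_k eta_k X^k are the components of L_X eta
    ([partial_local_pairing]).  Hence eta(X) is a constant k along each flow
    line ([is_derive_pairing]), and t |-> G (Phi t x) has the constant slope
    k^2.  On a compact manifold G is bounded, and a function on the real line
    that is bounded above cannot have a constant positive slope
    ([bounded_cst_slope]); so k^2 = 0 and G is constant along the orbit.

    Tangent vectors at a point are stored through one selected chart, whereas
    components are taken in an arbitrary chart.  The two descriptions are
    reconciled by [pairing_in_chart], and derivatives along curves are computed
    in the selected chart by [is_derive_along]. *)

(** * Calculus in charts *)

Section Charts.
Context {R : realType} {n : nat} {M : manifold R n}.
Implicit Types (c d : chart R n M) (p : 'rV[R]_n).

Lemma smooth_on_differentiable (V W : normedModType R) (A : set V)
    (f : V -> W) (p : V) : smooth_on A f -> A p -> differentiable f p.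
Proof. by move=> /(_ 1%N) [+ _]; apply. Qed.

Lemma transition_differentiable c d p : atlas c -> atlas d ->
  chart_cod c p -> chart_dom d (chart_inv c p) ->
  differentiable (transition c d) p.
Proof.
move=> ac ad cp dp; apply: smooth_on_differentiable (atlas_compatible ac ad) _.
exists (chart_inv c p); last exact: chart_invK.
by split=> //; exact: chart_inv_dom.
Qed.

Lemma near_chart_cod c p : chart_cod c p -> \forall q \near p, chart_cod c q.
Proof. by move=> cp; apply: open_nbhs_nbhs; split=> //; exact: chart_cod_open. Qed.

Lemma near_chart_dom c (x : M) :
  chart_dom c x -> \forall y \near x, chart_dom c y.
Proof. by move=> cx; apply: open_nbhs_nbhs; split=> //; exact: chart_dom_open. Qed.

(** The two transition maps are mutually inverse near p, so the chain rule makes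
    their differentials mutually inverse. *)
Lemma diff_transitionK c d p v : atlas c -> atlas d ->
    chart_cod c p -> chart_dom d (chart_inv c p) ->
  'd (transition d c) (transition c d p) ('d (transition c d) p v) = v.
Proof.
move=> ac ad cp dp.
have tK q : chart_cod c q -> chart_dom d (chart_inv c q) ->
    transition d c (transition c d q) = q.
  by move=> cq dq; rewrite /transition chart_mapK// chart_invK.
have df : differentiable (transition c d) p by exact: transition_differentiable.
have dg : differentiable (transition d c) (transition c d p).
  apply: transition_differentiable => //; first exact: chart_map_cod.
  by rewrite /transition chart_mapK//; exact: chart_inv_dom.
have dgf : differentiable (transition d c \o transition c d) p.
  exact: differentiable_comp.
transitivity ('D_v (transition d c \o transition c d) p).
  apply: esym; apply: etrans (deriveE v dgf) _.
  exact: (congr1 (fun h => h v) (diff_comp df dg)).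
(* The composite agrees with the identity only near p, so the comparison is made
   on directional derivatives, which depend on the germ alone. *)
rewrite -[RHS](derive_id p v); apply: near_eq_derive.
have cont : {for p, continuous (chart_inv c)}.
  by apply: chart_inv_cont; rewrite inE.
have := cont _ (near_chart_dom dp).
apply: filterS2 (near_chart_cod cp) => q cq dq /=.
exact: tK.
Qed.

(** The contraction a(X) does not depend on coordinates: covector components
    transform by the differential of one transition map, vector components by
    the differential of its inverse, and the two cancel. *)
Lemma pairing_in_chart (a : form1 M) (X : vector_field M) c p : atlas c ->
    chart_cod c p ->
  \sum_(k < n) comp1 a c k p * vcomp X c p 0 k =
  a (chart_inv c p) (X (chart_inv c p)).
Proof.
move=> ac cp; set x := chart_inv c p; set e := chart_at x.
have ex : chart_dom e x by exact: chart_at_dom.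
have ae : atlas e by exact: chart_at_atlas.
have tp : transition e c (e x) = p by rewrite /transition chart_mapK// chart_invK.
transitivity (a x ('d (transition c e) p (vcomp X c p))).
  rewrite [in RHS](row_sum_delta (vcomp X c p)) !linear_sum.
  by apply: eq_bigr => k _; rewrite !linearZ mulrC.
congr (a x _); rewrite /vcomp -/x -/e -[X in 'd _ X _]tp.
apply: diff_transitionK => //; first exact: chart_map_cod.
by rewrite chart_mapK//; exact: chart_inv_dom.
Qed.

(** The chain rule for a function on M read along a curve.  The local expression
    H is a separate argument because it is often more convenient than
    F \o chart_inv, to which it need only be equal on the chart: the sum of
    products of components used for eta(X) is an example. *)
Lemma is_derive_along (F : M -> R) (H : 'rV[R]_n -> R^o) (g : R -> M) (t : R) v :
    let c := chart_at (g t) in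
    (forall p, chart_cod c p -> F (chart_inv c p) = H p) ->
    differentiable H (c (g t)) -> has_velocity g t v ->
  is_derive t 1 (F \o g) ('d H (c (g t)) v).
Proof.
move=> c FH dH [cg vg].
have dcg : differentiable (fun s => c (g s)) t.
  by apply/derivable1_diffP; case: vg.
have gt : chart_dom c (g t) by exact: chart_at_dom.
apply: (@near_eq_is_derive _ _ _ (H \o (fun s => c (g s)))).
  have cgs : \forall s \near t, chart_dom c (g s) := cg _ (near_chart_dom gt).
  apply: filterS cgs => s cs /=.
  by rewrite -FH ?chart_mapK//; exact: chart_map_cod.
have dHcg : differentiable (H \o (fun s => c (g s))) t.
  exact: differentiable_comp.
apply: DeriveDef; first exact: diff_derivable.
have <- : 'D_1 (fun s => c (g s)) t = v by exact: (@derive_val _ _ _ _ _ _ _ vg).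
apply: etrans (deriveE _ dHcg) _; rewrite deriveE//.
exact: (congr1 (fun h => h 1) (diff_comp dcg dH)).
Qed.

Lemma is_derive_smooth_fun (F : M -> R) (g : R -> M) (t : R) v :
    smooth_fun F -> has_velocity g t v ->
  is_derive t 1 (F \o g) (differential F (g t) v).
Proof.
move=> sF gv; rewrite /differential lfunE; apply: is_derive_along => //.
apply: smooth_on_differentiable (sF _ (chart_at_atlas _)) _.
by apply: chart_map_cod; exact: chart_at_dom.
Qed.

Lemma smooth_fun_continuous (F : M -> R) : smooth_fun F -> continuous F.
Proof.
move=> sF x; set c := chart_at x.
have cx : chart_dom c x by exact: chart_at_dom.
have dF : differentiable (fun p => F (chart_inv c p)) (c x).
  apply: smooth_on_differentiable (sF c (chart_at_atlas x)) _.
  exact: chart_map_cod.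
have cont : {for x, continuous ((fun p => F (chart_inv c p)) \o c)}.
  apply: continuous_comp; last exact: differentiable_continuous.
  by apply: chart_map_cont; rewrite inE.
rewrite /continuous_at -[in X in _ --> X](chart_mapK cx).
apply: cvg_trans cont; apply: near_eq_cvg.
by apply: filterS (near_chart_dom cx) => y cy /=; rewrite chart_mapK.
Qed.

Lemma diff_eq0_partial (H : 'rV[R]_n -> R) p v : differentiable (H : _ -> R^o) p ->
  (forall k, partial k H p = 0) -> 'd (H : _ -> R^o) p v = 0.
Proof.
move=> dH H0; rewrite (row_sum_delta v) linear_sum big1// => k _.
by rewrite linearZ /= -deriveE// -/(partial k H p) H0 scaler0.
Qed.

End Charts.

(** * A closed 1-form contracted with a field that preserves it *)

Section InvariantClosedForm.
Context {R : realType} {n : nat} {M : manifold R n}.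
Context (eta : form1 M) (X : vector_field M).
Context (eta_smooth : smooth_form1 eta) (eta_closed : closed1 eta).
Context (X_smooth : smooth_vector_field X).
Context (lieX : forall c k p, atlas c -> chart_cod c p -> lie1 X eta c k p = 0).

Let local_pairing (c : chart R n M) : 'rV[R]_n -> R^o :=
  \sum_(k < n) (comp1 eta c k * (fun p => vcomp X c p 0 k)).

Let vcomp_differentiable c k p : atlas c -> chart_cod c p ->
  differentiable (fun q => vcomp X c q 0 k : R^o) p.
Proof.
move=> ac cp; apply: (@differentiable_comp _ _ _ _ (vcomp X c)
  (fun N : 'rV[R]_n => N 0 k : R^o)); last exact: differentiable_coord.
exact: smooth_on_differentiable (@X_smooth c ac) cp.
Qed.

Let comp1_differentiable c k p : atlas c -> chart_cod c p ->
  differentiable (comp1 eta c k : _ -> R^o) p.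
Proof. by move=> ac; apply: smooth_on_differentiable (@eta_smooth c k ac). Qed.

Let local_pairing_differentiable c p : atlas c -> chart_cod c p ->
  differentiable (local_pairing c) p.
Proof.
move=> ac cp; apply: differentiable_sum => k; apply: differentiableM.
  exact: comp1_differentiable.
exact: vcomp_differentiable.
Qed.

(** Cartan's formula in coordinates.  The product rule gives
    sum_k (eta_k d_l X^k + X^k d_l eta_k), which is (L_X eta)_l once closedness
    has replaced d_l eta_k by d_k eta_l. *)
Let partial_local_pairing c l p : atlas c -> chart_cod c p ->
  partial l (local_pairing c) p = 0.
Proof.
move=> ac cp; rewrite -(@lieX c l p ac cp) /partial /lie1 derive_sum; last first.
  move=> k; apply: derivableM; apply: diff_derivable.
    exact: comp1_differentiable.
  exact: vcomp_differentiable.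
apply: eq_bigr => k _; rewrite deriveM.
- rewrite addrC; congr (_ * _ + _).
  by have /eqP := @eta_closed c l k p ac cp; rewrite subr_eq0 => /eqP.
- by apply: diff_derivable; exact: comp1_differentiable.
- by apply: diff_derivable; exact: vcomp_differentiable.
Qed.

(** Stated for any curve, not just for the integral curves of X: the whole
    differential of eta(X) vanishes. *)
Lemma is_derive_pairing (g : R -> M) (t : R) v : has_velocity g t v ->
  is_derive t 1 (fun s => eta (g s) (X (g s)) : R) 0.
Proof.
set c := chart_at (g t) => gv.
have ac : atlas c by exact: chart_at_atlas.
have cp : chart_cod c (c (g t)) by apply: chart_map_cod; exact: chart_at_dom.
have dH := local_pairing_differentiable ac cp.
have <- : 'd (local_pairing c) (c (g t)) v = 0.
  by apply: diff_eq0_partial dH _ => k; exact: partial_local_pairing.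
apply: (is_derive_along (F := fun x => eta x (X x))) dH gv => p cp'.
rewrite -pairing_in_chart// /local_pairing fct_sumE; exact: eq_bigr.
Qed.

End InvariantClosedForm.

(** * Constancy along the flow *)

Lemma flat_diag (R : realType) (n : nat) (M : manifold R n) (eta : form1 M)
    (w : form2 M) (X : vector_field M) (x : M) : Defs.alternating w ->
  flat eta w X x (X x) = (eta x (X x) : R) ^+ 2.
Proof.
by move=> alt; rewrite /flat /flat_at add_lfunE scale_lfunE alt add0r expr2.
Qed.

Lemma bounded_cst_slope (R : realType) (q : R -> R) (k b : R) :
  (forall t : R, is_derive t 1 q k) -> (forall t, q t <= b) -> 0 <= k -> k = 0.
Proof.
move=> dq qb k0; apply/eqP; rewrite eq_le k0 andbT leNgt; apply/negP => kp.
have qE t : q t = q 0 + k * t.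
  have : (q - k *: (id : R -> R)) t = (q - k *: (id : R -> R)) 0.
    apply: is_derive_0_is_cst => s.
    have -> : 0 = k - k *: 1 :> R by rewrite [_ *: _]mulr1 subrr.
    exact: is_deriveB.
  rewrite !fctE /GRing.scale /= mulr0 subr0 => /eqP.
  by rewrite subr_eq => /eqP.
(* At this time the affine function q takes the value b + 1. *)
have := qb ((b - q 0 + 1) / k).
by rewrite qE mulrC divfK ?gt_eqF// addrA [q 0 + _]addrC subrK gerDl ler10.
Qed.

Theorem lemma2p5 (R : realType) (n : nat) (M : manifold R n)
    (eta : form1 M) (w : form2 M) (X : vector_field M) (G : M -> R)
    (Phi : R -> M -> M) :
  compact [set: M] ->
  is_cosymplectic eta w ->
  coHamiltonian eta w X ->
  smooth_fun G ->
  flat eta w X = differential G ->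
  is_flow X Phi ->
  forall x y z : M, flow_orbit Phi x y -> flow_orbit Phi x z -> G y = G z.
Proof.
move=> cM [[eta_smooth eta_closed] [alt _ _] _] [[X_smooth lieX _] _] sG flatG.
move=> [Phi0 PhiX] x y z [t ->] [u ->].
pose k : R := eta x (X x).
have etaX s : eta (Phi s x) (X (Phi s x)) = k.
  (* k is the value of the constant function at time 0. *)
  rewrite /k -{3 4}(Phi0 x).
  apply: (@is_derive_0_is_cst _ (fun s => eta (Phi s x) (X (Phi s x)) : R)) => r.
  exact: is_derive_pairing (PhiX x r).
have dG (s : R) : is_derive s 1 (fun r => G (Phi r x)) (k ^+ 2).
  have := is_derive_smooth_fun sG (PhiX x s).
  by rewrite -flatG flat_diag// etaX.
have [|m _ Gm] := compact_EVT_max (ex_intro _ x I) cM (f := G).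
  by apply: continuous_subspaceT; exact: smooth_fun_continuous.
have k0 : k ^+ 2 = 0.
  apply: (bounded_cst_slope (b := G m)) dG _ (sqr_ge0 k) => s.
  by apply: Gm; rewrite inE.
by apply: (@is_derive_0_is_cst _ (fun r => G (Phi r x))) => s; rewrite -k0.
Qed.
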